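(* Let $\varGamma$ be a tropical curve. Then $\operatorname{Rat}(\varGamma)$ is finitely generated as a $\boldsymbol{T}$-algebra if and only if $\varGamma$ is a singleton.
   Context: Graphs are unweighted, undirected, finite, connected, nonempty multigraphs that may have loops. The valence of a vertex is the number of incident edges, loops counted twice; a leaf end is a vertex of valence one; a leaf edge is an edge incident to a leaf end. An edge-weighted graph $(G,l)$ is a graph $G$ with a function $l : E(G) \to \boldsymbol{R}_{>0} \cup \{\infty\}$ that takes the value $\infty$ only on leaf edges. A tropical curve is the underlying topological space of an edge-weighted graph $(G,l)$ together with an identification of each edge $e$ with $[0,l(e)]$, where $[0,\infty]$ is the one-point compactification of $[0,\infty)$; if $l(e)=\infty$, the leaf end of $e$ is identified with $\infty$ (if $E(G)=\{e\}$ and $l(e)=\infty$, either leaf end may be identified with $\infty$). Points identified with $\infty$ are called points at infinity; all other points are finite points. A rational function on $\varGamma$ is either the constant function $-\infty$, or a continuous map $f : \varGamma \to \boldsymbol{R} \cup \{\pm\infty\}$ that is piecewise affine with integer slopes and finitely many pieces and that takes the values $\pm\infty$ only at points at infinity. $\operatorname{Rat}(\varGamma)$ is the set of all rational functions on $\varGamma$, with $(f \oplus g)(x) = \max\{f(x),g(x)\}$ and $(f \odot g)(x) = f(x)+g(x)$ at finite points $x$, extended continuously to points at infinity (and $f \odot (-\infty) = -\infty$). This is a semifield with zero element $-\infty$ and unit the constant function $0$. The tropical semifield $\boldsymbol{T}=(\boldsymbol{R}\cup\{-\infty\},\max,+)$ is included in it as the constant functions, making $\operatorname{Rat}(\varGamma)$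 a $\boldsymbol{T}$-algebra. $\operatorname{Rat}(\varGamma)$ is finitely generated as a $\boldsymbol{T}$-algebra if there is a finite subset such that the smallest subsemiring of $\operatorname{Rat}(\varGamma)$ containing $\boldsymbol{T}$ and this subset is $\operatorname{Rat}(\varGamma)$ (so only $\oplus$ and $\odot$, not multiplicative inverses, are used). *)

(* Defs.v *)
From HB Require Import structures.
From mathcomp Require Import all_boot all_order all_algebra.
From mathcomp Require Import all_classical all_reals all_analysis.

Set Implicit Arguments.
Unset Strict Implicit.
Unset Printing Implicit Defensive.

Import Order.TTheory GRing.Theory Num.Theory.
Import numFieldNormedType.Exports.

Local Open Scope classical_set_scope.
Local Open Scope ring_scope.

(* Edges are undirected: nothing graph-theoretic below depends on which end of
   an edge is its [origin]. The labelling of the two ends only records, in a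
   tropical curve, how the edge is identified with the interval [0, l(e)]. *)
Record multigraph := Multigraph {
  vertex : finType;
  edge : finType;
  origin : edge -> vertex;
  target : edge -> vertex;
  adjacent : rel vertex := fun u v => [exists e,
    ((origin e == u) && (target e == v)) || ((origin e == v) && (target e == u))];
  multigraph_nonempty : (0 < #|vertex|)%N;
  multigraph_connected : forall u v, connect adjacent u v
}.

(* A loop at [v] occurs in both sets, so it is counted twice. *)
Definition valence (G : multigraph) (v : vertex G) : nat :=
  (#|[set e | origin e == v]%SET| + #|[set e | target e == v]%SET|)%N.

Definition leaf_end (G : multigraph) (v : vertex G) : bool := valence v == 1%N.

(* The edge [e] is identified with [0, edge_length e], with [origin e] at 0 and
   [target e] at [edge_length e]. The last field states both that infinite edges
   are leaf edges and that the end put at infinity is a leaf end. *)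
Record tropical_curve (R : realType) := TropicalCurve {
  model :> multigraph;
  edge_length : edge model -> \bar R;
  length_gt0 : forall e, (0 < edge_length e)%E;
  length_infinite : forall e, edge_length e = +oo%E -> leaf_end (target e)
}.

(* The space obtained by gluing the intervals [0, edge_length e] at the vertices:
   a point is a vertex, or lies in the interior of exactly one edge. *)
Definition curve_point (R : realType) (C : tropical_curve R) : Type :=
  (vertex C +
   {et : edge C * R | (0 < et.2) && (et.2%:E < edge_length et.1)%E})%type.

HB.instance Definition _ (R : realType) (C : tropical_curve R) :=
  Choice.on (curve_point C).

Section Curve.
Variables (R : realType) (C : tropical_curve R).

Definition vertex_point (v : vertex C) : curve_point C := inl v.

(* The identification map from [0, edge_length e] to the curve; its values at other
   arguments are irrelevant. [insub] succeeds exactly at interior points. *)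
Definition edge_point (e : edge C) (t : \bar R) : curve_point C :=
  if (t <= 0)%E then vertex_point (origin e)
  else if (edge_length e <= t)%E then vertex_point (target e)
  else if insub (e, fine t) is Some x then inr x else vertex_point (target e).

(* Quotient topology from the disjoint union of the intervals; no condition
   arises for the one-vertex graph without edges, whose space is discrete. *)
Definition point_open : set_system (curve_point C) := [set U | forall e : edge C,
  open (edge_point e @^-1` U : set (subspace `[0%E, edge_length e]))].

Lemma point_openT : point_open setT.
Proof. by move=> e; rewrite preimage_setT; exact: openT. Qed.

Lemma point_openI : setI_closed point_open.
Proof. by move=> U V oU oV e; rewrite preimage_setI; exact: openI. Qed.

Lemma point_open_bigU (I : Type) (U : I -> set (curve_point C)) :
  (forall i, point_open (U i)) -> point_open (\bigcup_i U i).
Proof.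
by move=> oU e; rewrite preimage_bigcup; apply: bigcup_open => i _; exact: oU.
Qed.

HB.instance Definition _ := isOpenTopological.Build (curve_point C)
  point_openT point_openI point_open_bigU.

Definition infinite_point : set (curve_point C) :=
  [set vertex_point (target e) | e in [set e | edge_length e = +oo%E]].

Definition finite_point : set (curve_point C) := ~` infinite_point.

(* Along every edge, finitely many intervals cover the finite parameters and
   on each of them the function is affine with integer slope. *)
Definition piecewise_affine (f : curve_point C -> \bar R) : Prop :=
  forall e : edge C, exists (n : nat) (I : 'I_n -> interval R)
      (slope : 'I_n -> int) (intercept : 'I_n -> R),
    (forall t : R, 0 <= t -> (t%:E <= edge_length e)%E -> exists i, t \in I i) /\
    (forall i (t : R), t \in I i -> 0 <= t -> (t%:E <= edge_length e)%E ->
       f (edge_point e t%:E) = (intercept i + (slope i)%:~R * t)%:E).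

Definition rational_functions : set (curve_point C -> \bar R) := [set f |
  f = cst -oo%E \/
  [/\ continuous f, piecewise_affine f &
      forall x : curve_point C, f x \isn't a fin_num -> infinite_point x]].

(* Continuous extension to the points at infinity of the restriction of [h] to
   the finite points. *)
Definition extend_to_infinity (h : curve_point C -> \bar R) : curve_point C -> \bar R :=
  fun x => if `[< finite_point x >] then h x
           else lim (h @ within finite_point (nbhs x)).

Definition tropical_add (f g : curve_point C -> \bar R) : curve_point C -> \bar R :=
  extend_to_infinity (fun x => Order.max (f x) (g x)).

Definition tropical_mul (f g : curve_point C -> \bar R) : curve_point C -> \bar R :=
  extend_to_infinity (fun x => (f x + g x)%E).

Definition tropical_constants : set (curve_point C -> \bar R) :=
  [set cst c | c in [set c : \bar R | (c < +oo)%E]].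

Definition Rat_subsemiring (S : set (curve_point C -> \bar R)) : Prop :=
  [/\ S `<=` rational_functions, S (cst -oo%E), S (cst 0%E),
      forall f g, S f -> S g -> S (tropical_add f g) &
      forall f g, S f -> S g -> S (tropical_mul f g)].

Definition Rat_finitely_generated : Prop :=
  exists A : set (curve_point C -> \bar R),
    [/\ finite_set A, A `<=` rational_functions &
        smallest Rat_subsemiring (tropical_constants `|` A) = rational_functions].

End Curve.

(* Main.v *)
Require Import Defs.
From mathcomp Require Import all_boot all_order all_algebra.
From mathcomp Require Import all_classical all_reals all_analysis.
From mathcomp Require Import lra.

(** Affine functions are convex, and both the sum and the maximum of convex
    functions are convex; no other operation is available in a T-algebra.
    Suppose that the curve has an edge [e] and that [Rat] is generated over [T]
    by finitely many functions. Each generator has finitely many affine pieces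
    along [e], so some nondegenerate interval [[u, v]] inside [e] lies in a
    single affine piece of every generator ([generators_midconvex]). All
    generators and all constants are then convex on [[u, v]], hence so is every
    rational function ([finitely_generated_midconvex]). But the tent function
    with peak over the midpoint of [[u, v]] is rational ([tent_rational]) and
    is not convex there. So a curve with finitely generated [Rat] has no edge,
    and a connected graph without edges is a single vertex.

    Conversely, on a singleton every rational function is constant, so that no
    generator beyond [T] is needed. *)

Set Implicit Arguments.
Unset Strict Implicit.
Unset Printing Implicit Defensive.

Import Order.TTheory GRing.Theory Num.Theory.
Import numFieldNormedType.Exports.

Local Open Scope classical_set_scope.
Local Open Scope ring_scope.

Section Curve.
Variables (R : realType) (C : tropical_curve R).
Implicit Types (e : edge C) (f g : curve_point C -> \bar R).

(** * Points of an edge *)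

Lemma edge_point_interior e (t : R) : 0 < t -> (t%:E < edge_length e)%E ->
  exists2 x, edge_point e t%:E = inr x & val x = (e, t).
Proof.
move=> t0 tl; rewrite /edge_point lee_fin leNgt t0 leNgt tl /=.
by case: insubP => [x _ xE|]; [exists x | rewrite /= t0 tl].
Qed.

Lemma finite_point_inr x : finite_point (inr x : curve_point C).
Proof. by case. Qed.

Lemma finite_point_edge_point e (t : R) : 0 < t -> (t%:E < edge_length e)%E ->
  finite_point (edge_point e t%:E).
Proof.
move=> t0 tl; have [x -> _] := edge_point_interior t0 tl.
exact: finite_point_inr.
Qed.

Lemma extend_to_infinity_finite (h : curve_point C -> \bar R) x :
  finite_point x -> extend_to_infinity h x = h x.
Proof. by move=> fx; rewrite /extend_to_infinity asboolT. Qed.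

Lemma exists_interior e : exists2 t : R, 0 < t & (t%:E < edge_length e)%E.
Proof.
have := length_gt0 e; case: (edge_length e) => [l||//] l0.
  by exists (l / 2); rewrite ?lte_fin in l0 *; lra.
by exists 1; rewrite ?ltry.
Qed.

(** * Midpoint convexity along an edge *)

(** The midpoint form of convexity involves only addition and order, so it makes
    sense for values in [\bar R], in particular for the constant [-oo]. *)
Definition edge_midconvex e (u v : R) f := forall s t : R,
  u <= s -> s <= t -> t <= v ->
  (f (edge_point e ((s + t) / 2)%:E) + f (edge_point e ((s + t) / 2)%:E) <=
   f (edge_point e s%:E) + f (edge_point e t%:E))%E.

Lemma edge_midconvex_cst e u v c : edge_midconvex e u v (cst c).
Proof. by move=> s t _ _ _ /=. Qed.

Lemma sub_edge_midconvex e u v u' v' f : u <= u' -> v' <= v ->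
  edge_midconvex e u v f -> edge_midconvex e u' v' f.
Proof.
by move=> uu vv fc s t us st tv; apply: fc => //;
  [exact: le_trans us | exact: le_trans vv].
Qed.

Section Interior.
Variables (e : edge C) (u v : R).
Hypotheses (u_gt0 : 0 < u) (v_lt : (v%:E < edge_length e)%E).

(* The extension at infinity does not affect a sum or a maximum at parameters
   in [[u, v]]: they are finite points. *)
Let fin (s : R) : u <= s -> s <= v -> finite_point (edge_point e s%:E).
Proof.
move=> us sv; apply: finite_point_edge_point; first exact: lt_le_trans us.
by apply: le_lt_trans v_lt; rewrite lee_fin.
Qed.

(** At the midpoint the maximum is one of [f] and [g]; convexity of that one
    suffices, as the maximum dominates it at both ends. *)
Lemma edge_midconvex_add f g : edge_midconvex e u v f ->
  edge_midconvex e u v g -> edge_midconvex e u v (tropical_add f g).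
Proof.
move=> fc gc s t us st tv; rewrite /tropical_add.
rewrite !extend_to_infinity_finite; try by apply: fin; lra.
case: (leP (f (edge_point e ((s + t) / 2)%:E))) => _.
  by apply: le_trans (gc s t us st tv) _; apply: leeD; rewrite le_max lexx orbT.
by apply: le_trans (fc s t us st tv) _; apply: leeD; rewrite le_max lexx.
Qed.

Lemma edge_midconvex_mul f g : edge_midconvex e u v f ->
  edge_midconvex e u v g -> edge_midconvex e u v (tropical_mul f g).
Proof.
move=> fc gc s t us st tv; rewrite /tropical_mul.
rewrite !extend_to_infinity_finite; try by apply: fin; lra.
by rewrite addeACA [leRHS]addeACA; apply: leeD; [exact: fc|exact: gc].
Qed.

End Interior.

(** Among [n + 1] points of [[u, v]] two lie in the same of the [n] affine
    pieces of [f], and then so does the interval between them. *)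
Lemma rational_midconvex e (u v : R) f : u < v -> 0 <= u ->
  (v%:E <= edge_length e)%E -> rational_functions f ->
  exists u' v', [/\ u <= u', u' < v', v' <= v & edge_midconvex e u' v' f].
Proof.
move=> uv u0 vl [->|[_ /(_ e)[n [I [a [b [cover affine]]]]] _]].
  by exists u, v; split=> //; exact: edge_midconvex_cst.
pose p (i : 'I_n.+1) : R := u + (v - u) * (i%:R / n.+1%:R).
have p_ge i : u <= p i.
  by rewrite /p lerDl mulr_ge0 ?divr_ge0// subr_ge0 ltW.
have p_le i : p i <= v.
  rewrite /p -lerBrDl ger_pMr ?subr_gt0// ler_pdivrMr ?ltr0n// mul1r ler_nat.
  exact: ltnW.
have p_lt (i j : 'I_n.+1) : (i < j)%N -> p i < p j.
  move=> ij; rewrite /p ltrD2l ltr_pM2l ?subr_gt0//.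
  by rewrite ltr_pM2r ?invr_gt0 ?ltr0n// ltr_nat.
have le_length (t : R) : t <= v -> (t%:E <= edge_length e)%E.
  by move=> tv; apply: le_trans vl; rewrite lee_fin.
have /choice[c cP] : forall i, exists k, p i \in I k.
  by move=> i; apply: cover; [exact: le_trans (p_ge i) | exact: le_length].
have /injectivePn[i [j ij cij]] : ~~ injectiveb c.
  by apply/negP => /injectiveP/leq_card; rewrite !card_ord ltnn.
wlog {ij} ij : i j cij / (i < j)%N.
  move=> H; move: ij; rewrite neq_ltn => /orP[|] lt; first exact: (H i j).
  exact: (H j i).
exists (p i), (p j); split=> //; first exact: p_lt.
have fE (s : R) : p i <= s -> s <= p j ->
    f (edge_point e s%:E) = (b (c i) + (a (c i))%:~R * s)%:E.
  move=> is_ sj; apply: affine; last 2 first.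
  - exact: le_trans (le_trans u0 (p_ge i)) is_.
  - by apply: le_length; exact: le_trans sj (p_le j).
  apply: (@interval_is_interval _ _ (p i) (p j)); rewrite /= ?is_ ?sj//.
  by rewrite cij.
move=> s t us st tv.
by rewrite !fE -?EFinD ?lee_fin; lra.
Qed.

Lemma generators_midconvex e (u v : R) (A : seq (curve_point C -> \bar R)) :
  u < v -> 0 <= u -> (v%:E <= edge_length e)%E ->
  [set` A] `<=` @rational_functions R C ->
  exists u' v', [/\ u <= u', u' < v', v' <= v &
    forall f, f \in A -> edge_midconvex e u' v' f].
Proof.
elim: A u v => [|f A IH] u v uv u0 vl ratA; first by exists u, v.
have ratf : rational_functions f by apply: ratA; rewrite /= mem_head.
have [u1 [v1 [uu1 uv1 vv1 fc]]] := rational_midconvex uv u0 vl ratf.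
have [||||u2 [v2 [uu2 uv2 vv2 Ac]]] := IH u1 v1 _ _ _ _ => //.
- exact: le_trans uu1.
- by apply: le_trans vl; rewrite lee_fin.
- by move=> g /= gA; apply: ratA; rewrite /= inE gA orbT.
exists u2, v2; split=> //; [exact: le_trans uu2|exact: le_trans vv1|].
move=> g; rewrite inE => /predU1P[->|]; last exact: Ac.
exact: sub_edge_midconvex fc.
Qed.

(** The hypothesis makes [Rat] the least subsemiring containing [T] and the
    generators, hence itself a subsemiring; its midpoint convex elements then
    form a subsemiring which contains [T] and the generators. *)
Lemma finitely_generated_midconvex e : Rat_finitely_generated C ->
  exists u v, [/\ 0 < u, u < v, (v%:E < edge_length e)%E &
    forall f, rational_functions f -> edge_midconvex e u v f].
Proof.
move=> [_ [/finite_seqP[A ->] ratA genA]].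
have [t t0 tl] := exists_interior e.
have [||||u [v [tu uv vt Ac]]] := @generators_midconvex e (t / 2) t A => //.
- by lra.
- by lra.
- exact: ltW.
have u0 : 0 < u by lra.
have vl : (v%:E < edge_length e)%E by apply: le_lt_trans tl; rewrite lee_fin.
exists u, v; split=> //.
have Tgen : @tropical_constants R C `|` [set` A] `<=` @rational_functions R C.
  by rewrite -genA => f Tf S [_]; exact.
(* If no subsemiring contained the generators, the intersection defining
   [smallest] would be the set of all functions, including the constant [+oo],
   which is not rational. *)
have [S [ringS genS]] : exists S, Rat_subsemiring S /\
    @tropical_constants R C `|` [set` A] `<=` S.
  apply: contrapT => noS.
  have : rational_functions (cst +oo%E : curve_point C -> \bar R).
    by rewrite -genA => S SP; case: noS; exists S.
  have [x xE _] := edge_point_interior t0 tl.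
  case=> [/(congr1 (@^~ (inr x)))//|[_ _ /(_ (inr x))]].
  by move=> /(_ isT); exact: finite_point_inr.
have minE S' : Rat_subsemiring S' ->
    @tropical_constants R C `|` [set` A] `<=` S' -> @rational_functions R C `<=` S'.
  by move=> ? ?; rewrite -genA => f; apply; split.
have ratE : @rational_functions R C = S.
  by apply/seteqP; split; [exact: minE|case: ringS].
have [_ S0 S1 SD SM] := ringS; rewrite -ratE in S0 S1 SD SM.
suff : @rational_functions R C `<=`
    @rational_functions R C `&` edge_midconvex e u v by move=> H f /H[].
apply: minE.
  split=> [f []//|||f g [fr fc] [gr gc]|f g [fr fc] [gr gc]].
  - by split=> //; exact: edge_midconvex_cst.
  - by split=> //; exact: edge_midconvex_cst.
  - by split; [exact: SD|exact: edge_midconvex_add].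
  - by split; [exact: SM|exact: edge_midconvex_mul].
move=> f Tf; split; first exact: Tgen.
case: Tf => [[c _ <-]|fA]; first exact: edge_midconvex_cst.
exact: Ac.
Qed.

(** * The tent function *)

Definition tent (u v t : R) : R := Num.max 0 (Num.min (t - u) (v - t)).

Lemma tent_outside u v t : u <= v -> (t <= u) || (v <= t) -> tent u v t = 0.
Proof.
move=> uv H; apply/max_idPl; rewrite ge_min !subr_le0.
by case/orP: H => ->; rewrite ?orbT.
Qed.

Definition edge_tent e (u v : R) : curve_point C -> \bar R := fun x =>
  match x with
  | inl _ => 0%E
  | inr et => if (val et).1 == e then (tent u v (val et).2)%:E else 0%E
  end.

Section Tent.
Variables (e : edge C) (u v : R).
Hypotheses (u_ge0 : 0 <= u) (uv : u <= v) (v_le : (v%:E <= edge_length e)%E).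

(** The formula holds for every [t], not only for parameters of the edge:
    [edge_point] sends the other arguments to a vertex, and [fine] sends both
    infinities to 0, where the tent vanishes. Hence continuity on the edge
    reduces to continuity on all of [\bar R]. *)
Lemma edge_tent_edge_point e' (t : \bar R) : edge_tent e u v (edge_point e' t) =
  if e' == e then (tent u v (fine t))%:E else 0%E.
Proof.
rewrite /edge_point; case: leP => [t0|t0] /=.
  case: eqP => // _; rewrite tent_outside//.
  by case: t t0 => [t||] //= t0; rewrite ?u_ge0// (le_trans _ u_ge0).
case: leP => [lt|tl] /=.
  case: eqP => // ee'; rewrite tent_outside//; move: lt; rewrite ee' => lt.
  case: t lt {t0} => [t||] /= lt; last 2 first.
  - by rewrite u_ge0.
  - by rewrite u_ge0.
  by rewrite -!lee_fin (le_trans v_le lt) orbT.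
have tE : t = (fine t)%:E.
  by rewrite fineK// fin_real// (lt_trans _ t0)// (lt_le_trans tl)// leey.
rewrite tE lte_fin in t0 tl.
by case: insubP => [x _ /= ->//|]; rewrite /= t0 tl.
Qed.

Lemma edge_tent_parameter (t : R) :
  edge_tent e u v (edge_point e t%:E) = (tent u v t)%:E.
Proof. by rewrite edge_tent_edge_point eqxx. Qed.

Lemma tent_continuous : continuous (tent u v).
Proof.
move=> x; apply: (@continuous_max _ _ (cst 0) (fun t => Num.min (t - u) (v - t))).
  exact: cvg_cst.
apply: (@continuous_min _ _ (fun t => t - u) (fun t => v - t)).
  by apply: cvgB; [exact: cvg_id|exact: cvg_cst].
by apply: cvgB; [exact: cvg_cst|exact: cvg_id].
Qed.

Lemma tent_fine_continuous :
  continuous (fun t : \bar R => (tent u v (fine t))%:E).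
Proof.
case=> [x||].
- by move=> U xU; exact: tent_continuous xU.
- apply: (@cvg_near_cst _ _ _ _ (nbhs (+oo%E : \bar R))).
  apply: filterS (ereal_nbhs_pinfty_ge (num_real v)).
  move=> y vy; congr EFin; rewrite !tent_outside//= ?u_ge0//.
  by case: y vy => [y||]//=; rewrite ?u_ge0// lee_fin => ->; rewrite orbT.
- apply: (@cvg_near_cst _ _ _ _ (nbhs (-oo%E : \bar R))).
  apply: filterS (ereal_nbhs_ninfty_le (num_real u)).
  move=> y yu; congr EFin; rewrite !tent_outside//= ?u_ge0//.
  by case: y yu => [y||]//=; rewrite ?u_ge0// lee_fin => ->.
Qed.

Lemma edge_tent_continuous : continuous (edge_tent e u v).
Proof.
apply/continuousP => U oU.
suff : point_open (edge_tent e u v @^-1` U) by [].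
move=> e'; apply: open_subspaceW.
have -> : edge_point e' @^-1` (edge_tent e u v @^-1` U) =
    (fun t => if e' == e then (tent u v (fine t))%:E else 0%E) @^-1` U.
  by apply/seteqP; split=> t; rewrite /= edge_tent_edge_point.
case: eqP => _.
  by move/continuousP: tent_fine_continuous; exact.
by apply: open_comp => // t _; exact: cvg_cst.
Qed.

Lemma edge_tent_piecewise_affine : piecewise_affine (edge_tent e u v).
Proof.
move=> e'; have [->|e'e] := eqVneq e' e; last first.
  exists 1%N, (fun=> `]-oo, +oo[), (fun=> 0), (fun=> 0); split=> [t _ _|_ t _ _ _].
    by exists ord0; rewrite in_itv.
  by rewrite edge_tent_edge_point (negbTE e'e) mul0r addr0.
pose m := (u + v) / 2.
exists 4, (fun i => nth `[0, 0] [:: `]-oo, u]; `[u, m]; `[m, v]; `[v, +oo[] i),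
  (fun i => [:: 0; 1; -1; 0]`_i), (fun i => [:: 0; -u; v; 0]`_i); split.
  move=> t _ _; case: (leP t u) => [tu|ut].
    by exists (@Ordinal 4 0 isT); rewrite in_itv.
  case: (leP t m) => [tm|mt].
    by exists (@Ordinal 4 1 isT); rewrite in_itv/= tm ltW.
  case: (leP t v) => [tv|vt].
    by exists (@Ordinal 4 2 isT); rewrite in_itv/= tv ltW.
  by exists (@Ordinal 4 3 isT); rewrite in_itv/= ltW.
case=> -[|[|[|[|//]]]] i t /=; rewrite in_itv /= => tI _ _;
  rewrite edge_tent_parameter; congr EFin.
- by rewrite mul0r addr0 tent_outside// tI.
- have /andP[ut tm] := tI; rewrite mul1r /tent min_l ?max_r; rewrite /m in tm *; lra.
- have /andP[mt tv] := tI; rewrite mulN1r /tent min_r ?max_r; rewrite /m in mt *; lra.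
- by rewrite andbT in tI; rewrite mul0r addr0 tent_outside// tI orbT.
Qed.

Lemma tent_rational : rational_functions (edge_tent e u v).
Proof.
right; split.
- exact: edge_tent_continuous.
- exact: edge_tent_piecewise_affine.
- by move=> [w|[et et_in]] /=; [|case: ifP].
Qed.

End Tent.

Lemma tent_not_midconvex e (u v : R) : 0 < u -> u < v ->
  (v%:E < edge_length e)%E -> ~ edge_midconvex e u v (edge_tent e u v).
Proof.
move=> u0 uv vl /(_ u v (lexx u) (ltW uv) (lexx v)).
rewrite !(edge_tent_parameter (ltW u0) (ltW uv) (ltW vl)).
rewrite (tent_outside (t := u) (ltW uv)) ?lexx//.
rewrite (tent_outside (t := v) (ltW uv)) ?lexx ?orbT//.
have tent_mid : 0 < tent u v ((u + v) / 2).
  by rewrite /tent min_l ?max_r; lra.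
by rewrite -!EFinD lee_fin; lra.
Qed.

(** * Curves without edges *)

Lemma finitely_generated_no_edge : Rat_finitely_generated C -> edge C -> False.
Proof.
move=> fg e; have [u [v [u0 uv vl conv]]] := finitely_generated_midconvex e fg.
apply: (tent_not_midconvex u0 uv vl); apply: conv.
by apply: tent_rational; apply: ltW.
Qed.

Lemma no_edge_singleton : (edge C -> False) ->
  exists x : curve_point C, [set: curve_point C] = [set x].
Proof.
move=> noe; have /card_gt0P[w _] := multigraph_nonempty C.
exists (inl w); apply/seteqP; split=> // -[v|[[e ?] ?]] _; last by case: (noe e).
have /connectP[[|v' p] /= pth ->//] := multigraph_connected w v.
by move: pth => /andP[/existsP[e]]; case: (noe e).
Qed.

Lemma singleton_no_edge (x : curve_point C) :
  [set: curve_point C] = [set x] -> edge C -> False.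
Proof.
move=> xE e; have [t t0 tl] := exists_interior e.
have [y _ _] := edge_point_interior t0 tl.
have eq_x z : z = x by have : [set x] z by rewrite -xE.
by have := eq_x (inr y); rewrite -(eq_x (inl (origin e))).
Qed.

Lemma singleton_finitely_generated (x : curve_point C) :
  [set: curve_point C] = [set x] -> Rat_finitely_generated C.
Proof.
move=> xE; have noe := singleton_no_edge xE.
have eq_x z : z = x by have : [set x] z by rewrite -xE.
have not_inf z : ~ infinite_point (z : curve_point C) by case=> e; case: (noe e).
have constE (f : curve_point C -> \bar R) : f = cst (f x).
  by apply/funext => z; rewrite (eq_x z).
have constP (c : \bar R) : (c < +oo)%E -> rational_functions (cst c : curve_point C -> \bar R).
  case: c => [r|//|] _; [right; split=> [z|e|z //]|by left].
    exact: cst_continuous.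
  by case: (noe e).
have ratP f : rational_functions f <-> (f x < +oo)%E.
  split=> [[->|[_ _ /(_ x) H]]|fx]; first by [].
    by case: (f x) H => [r|H|//] //; rewrite ?ltry//; case: (not_inf x (H isT)).
  by rewrite (constE f); exact: constP.
exists set0; split=> //; rewrite setU0; apply/seteqP; split.
  apply: smallest_sub => //.
    split=> // [||f g /ratP fx /ratP gx|f g /ratP fx /ratP gx].
    - exact: constP.
    - exact: constP.
    - apply/ratP; rewrite /tropical_add extend_to_infinity_finite; last exact: not_inf.
      by rewrite gt_max fx gx.
    - apply/ratP; rewrite /tropical_mul extend_to_infinity_finite; last exact: not_inf.
      exact: lte_add_pinfty.
  by move=> f [c cy <-]; exact: constP.
move=> f /ratP fx; apply: sub_gen_smallest; by exists (f x).
Qed.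

End Curve.

Theorem proposition3p14 (R : realType) (C : tropical_curve R) :
  Rat_finitely_generated C <-> exists x : curve_point C, [set: curve_point C] = [set x].
Proof.
split=> [fg|[x xE]].
  by apply: no_edge_singleton; exact: finitely_generated_no_edge.
exact: singleton_finitely_generated xE.
Qed.
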